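(* Let $N^n\subset M^{n+1}\subset\mathbb{R}^{n+2}$ be a non-degenerate immersion, $\phi:U\subset\mathbb{R}^n\to\mathbb{R}^{n+2}$ a parameterization of $N$, and $\xi(t)$ a nowhere-vanishing vector field in the osculating Darboux direction of $N\subset M$. Let $ET_N(t,u)=\phi(t)+u\,\xi(t)$, $t\in U$, $u\in\mathbb{R}$, be the envelope of tangent spaces of $M$ along $N$, and let $S_1$ be the shape operator associated with $\xi$. If $u_0$ is not the inverse of a non-zero eigenvalue of $S_1$ at $\phi(t_0)$, then the hypersurface $ET_N$ is smooth at $(t_0,u_0)$, i.e. $ET_N$ maps a sufficiently small neighborhood of $(t_0,u_0)$ onto a smooth hypersurface of $\mathbb{R}^{n+2}$.
   Context: $D$ is the standard flat connection of $\mathbb{R}^{n+2}$. $M$ is a smooth hypersurface and $N$ a codimension $1$ immersed submanifold of $M$. For $\eta$ along $N$ transversal to $M$ and $\xi_1$ along $N$ tangent to $M$ and transversal to $N$, write $D_XY=\nabla_XY+h^1(X,Y)\xi_1+h^2(X,Y)\eta$ with $\nabla_XY$ tangent to $N$, for $X,Y$ tangent to $N$. The immersion is non-degenerate if $h^2$ is a non-degenerate bilinear form at each point (independent of choices). In that case there is a unique direction along $N$, tangent to $M$ and transversal to $N$, spanned by $\xi$ with $D_X\xi$ tangent to $M$ for all $X\in TN$, called the osculating Darboux direction. For such $\xi$, the shape operator $S_1$ (a $(1,1)$-tensor on $N$) and the $1$-form $\tau_1^1$ are defined by $D_X\xi=-S_1X+\tau_1^1(X)\xi$. *)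

(* Defs.v *)
From mathcomp Require Import all_boot all_order all_algebra.
From mathcomp Require Import all_classical all_reals all_analysis.

Set Implicit Arguments.
Unset Strict Implicit.
Unset Printing Implicit Defensive.

Import Order.TTheory GRing.Theory Num.Theory.
Import numFieldNormedType.Exports.

Local Open Scope classical_set_scope.
Local Open Scope ring_scope.

(* Points and vectors of R^k are row vectors 'rV[R]_k. Maps defined on an open
   set U are total functions of which only the values on U matter. The flat
   connection D of R^m, along a map with domain U, is the directional
   derivative 'D_X V t of the field V : U -> R^m. *)

Fixpoint Ck_on (R : realType) (V W : normedModType R) (k : nat) (U : set V)
    (f : V -> W) : Prop :=
  match k with
  | 0 => forall x, U x -> {for x, continuous f}
  | k'.+1 => (forall x, U x -> differentiable f x) /\
             (forall v, Ck_on k' U (fun x => 'D_v f x))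
  end.

Definition smooth_on (R : realType) (V W : normedModType R) (U : set V)
    (f : V -> W) : Prop :=
  forall k, Ck_on k U f.

Definition immersion_on (R : realType) (V W : normedModType R) (U : set V)
    (f : V -> W) : Prop :=
  smooth_on U f /\ forall t, U t -> injective ('d f t).

(* psi parameterizes an open piece of the set M: it is an immersion and a
   homeomorphism of V onto a relatively open subset of M (the last clause says
   that psi is an open map into M). *)
Definition local_parameterization (R : realType) (k m : nat)
    (M : set 'rV[R]_m) (V : set 'rV[R]_k) (psi : 'rV[R]_k -> 'rV[R]_m) : Prop :=
  [/\ open V, immersion_on V psi, {in V &, injective psi} &
      forall V', open V' -> V' `<=` V ->
        exists2 W, open W & psi @` V' = M `&` W].

Definition smooth_hypersurface (R : realType) (k : nat)
    (M : set 'rV[R]_k.+1) : Prop :=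
  forall p, M p -> exists (V : set 'rV[R]_k) (psi : 'rV[R]_k -> 'rV[R]_k.+1),
    local_parameterization M V psi /\ (psi @` V) p.

Definition tangent_space (R : realType) (k : nat) (M : set 'rV[R]_k.+1)
    (p : 'rV[R]_k.+1) : set 'rV[R]_k.+1 :=
  [set v | exists (V : set 'rV[R]_k) (psi : 'rV[R]_k -> 'rV[R]_k.+1) s w,
     [/\ local_parameterization M V psi, V s, psi s = p & v = 'd psi s w]].

(* An n-dimensional immersed submanifold of R^m is given by a space N and a map
   iota : N -> R^m. A local coordinate system of N is the inverse of a
   homeomorphism psi from an open subset U of R^n onto an open subset of N, and
   it belongs to the smooth structure for which iota is an immersion exactly
   when iota \o psi is an immersion: two such psi automatically have smooth
   transition maps, so no atlas has to be carried along. The corresponding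
   parameterization of the submanifold is phi = iota \o psi. *)
Definition parameterization_of (R : realType) (n m : nat) (N : topologicalType)
    (iota : N -> 'rV[R]_m) (U : set 'rV[R]_n) (psi : 'rV[R]_n -> N)
    (phi : 'rV[R]_n -> 'rV[R]_m) : Prop :=
  [/\ open U, (forall t, U t -> {for t, continuous psi}),
      {in U &, injective psi},
      (forall V, open V -> V `<=` U -> open (psi @` V)) &
      immersion_on U phi /\ {in U, phi =1 iota \o psi}].

Definition immersed_submanifold (R : realType) (n m : nat)
    (N : topologicalType) (iota : N -> 'rV[R]_m) : Prop :=
  [/\ hausdorff_space N, @second_countable N &
      forall x : N, exists (U : set 'rV[R]_n) psi phi,
        parameterization_of iota U psi phi /\ (psi @` U) x].

Definition immersed_hypersurface_of (R : realType) (n : nat)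
    (M : set 'rV[R]_n.+2) (N : topologicalType) (iota : N -> 'rV[R]_n.+2)
    : Prop :=
  immersed_submanifold n iota /\ range iota `<=` M.

(* The tangent space of N at phi t; a tangent vector is represented by its
   coordinate vector X, and stands for 'd phi t X. *)
Definition tangent_image (R : realType) (n m : nat)
    (phi : 'rV[R]_n -> 'rV[R]_m) (t : 'rV[R]_n) : set 'rV[R]_m :=
  range ('d phi t).

Definition transversal_fields (R : realType) (n : nat) (M : set 'rV[R]_n.+2)
    (V : set 'rV[R]_n) (phi xi1 eta : 'rV[R]_n -> 'rV[R]_n.+2) : Prop :=
  [/\ smooth_on V xi1, smooth_on V eta &
      forall t, V t ->
        [/\ tangent_space M (phi t) (xi1 t), ~ tangent_image phi t (xi1 t) &
            ~ tangent_space M (phi t) (eta t)]].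

(* D_X Y = nabla_X Y + h^1(X,Y) xi_1 + h^2(X,Y) eta at each point t of V, for
   every vector X and vector field Y tangent to N. Since xi_1 and eta are
   transversal, this equation determines nabla, h1 and h2 on V, and makes h1 t
   and h2 t bilinear. *)
Definition gauss_formula (R : realType) (n : nat) (V : set 'rV[R]_n)
    (phi xi1 eta : 'rV[R]_n -> 'rV[R]_n.+2)
    (nabla : 'rV[R]_n -> 'rV[R]_n -> ('rV[R]_n -> 'rV[R]_n) -> 'rV[R]_n)
    (h1 h2 : 'rV[R]_n -> 'rV[R]_n -> 'rV[R]_n -> R) : Prop :=
  forall (X : 'rV[R]_n) (Y : 'rV[R]_n -> 'rV[R]_n), smooth_on V Y ->
  forall t, V t ->
    'D_X (fun s => 'd phi s (Y s)) t =
      'd phi t (nabla t X Y) + h1 t X (Y t) *: xi1 t + h2 t X (Y t) *: eta t.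

Definition nondegenerate_form (R : realType) (n : nat)
    (h : 'rV[R]_n -> 'rV[R]_n -> R) : Prop :=
  forall X, (forall Y, h X Y = 0) -> X = 0.

(* The fields xi_1 and eta need only exist near each point, and the
   non-degeneracy of h2 does not depend on their choice. *)
Definition nondegenerate_immersion (R : realType) (n : nat)
    (M : set 'rV[R]_n.+2) (N : topologicalType) (iota : N -> 'rV[R]_n.+2)
    : Prop :=
  forall (U : set 'rV[R]_n) psi phi, parameterization_of iota U psi phi ->
  forall t, U t ->
  exists (V : set 'rV[R]_n) xi1 eta nabla h1 h2,
    [/\ open V, V t, V `<=` U, transversal_fields M V phi xi1 eta &
        gauss_formula V phi xi1 eta nabla h1 h2 /\
        forall s, V s -> nondegenerate_form (h2 s)].

(* L t is the line in R^(n+2) giving the osculating Darboux direction at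
   phi t. *)
Definition osculating_darboux_direction (R : realType) (n : nat)
    (M : set 'rV[R]_n.+2) (U : set 'rV[R]_n) (phi : 'rV[R]_n -> 'rV[R]_n.+2)
    (L : 'rV[R]_n -> set 'rV[R]_n.+2) : Prop :=
  forall t, U t ->
  exists (V : set 'rV[R]_n) (zeta : 'rV[R]_n -> 'rV[R]_n.+2),
    [/\ open V, V t, V `<=` U, smooth_on V zeta &
        forall s, V s ->
          [/\ tangent_space M (phi s) (zeta s),
              ~ tangent_image phi s (zeta s),
              forall X, tangent_space M (phi s) ('D_X zeta s) &
              L s = range (fun c : R => c *: zeta s)]].

(* D_X xi = - S_1 X + tau_1^1(X) xi. S1 t is the matrix of the shape operator
   in the coordinate frame of phi, acting on row vectors: S_1 X is represented
   by X *m S1 t. As xi is transversal to N, the equation determines S1 and tau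
   on U. *)
Definition shape_operator (R : realType) (n : nat) (U : set 'rV[R]_n)
    (phi xi : 'rV[R]_n -> 'rV[R]_n.+2)
    (S1 : 'rV[R]_n -> 'M[R]_n) (tau : 'rV[R]_n -> 'rV[R]_n -> R) : Prop :=
  forall t, U t -> forall X : 'rV[R]_n,
    'D_X xi t = - 'd phi t (X *m S1 t) + tau t X *: xi t.

Definition envelope (R : realType) (n m : nat)
    (phi xi : 'rV[R]_n -> 'rV[R]_m) (p : 'rV[R]_n * R) : 'rV[R]_m :=
  phi p.1 + p.2 *: xi p.1.

(* The image under f of every sufficiently small open neighborhood of p is a
   smooth hypersurface. *)
Definition smooth_hypersurface_at (R : realType) (k : nat)
    (T : topologicalType) (D : set T) (f : T -> 'rV[R]_k.+1) (p : T) : Prop :=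
  exists O : set T, [/\ open O, O p, O `<=` D &
    forall O', open O' -> O' p -> O' `<=` O -> smooth_hypersurface (f @` O')].

(* Main.v *)
(* The differential of E(t,u) = phi(t) + u xi(t) at (t0,u0) sends (X,a) to
   dphi(X - u0 S1 X) + (u0 tau(X) + a) xi. Since xi is transversal to N, a kernel
   vector satisfies X = u0 S1 X, so X = 0 because 1/u0 is not an eigenvalue of S1,
   and then a = 0. Hence E is an immersion at (t0,u0); being C^1, it satisfies
   |x - y| <= c |E x - E y| near that point, which makes it a homeomorphism of
   every small open set onto its image. *)
From HB Require Import structures.
Require Import Defs.
From mathcomp Require Import all_boot all_order all_algebra.
From mathcomp Require Import all_classical all_reals all_analysis.
From mathcomp Require Import ring lra.

Set Implicit Arguments.
Unset Strict Implicit.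
Unset Printing Implicit Defensive.

Import Order.TTheory GRing.Theory Num.Theory.
Import numFieldNormedType.Exports.

Local Open Scope classical_set_scope.
Local Open Scope ring_scope.

(** * Product rule for scaling, locality of the differential, continuity of linear maps *)

Section differentiability.
Context {R : realType}.
Implicit Types V W : normedModType R.

Lemma scaler_is_bilinear W :
  bilinear_for
    (GRing.Scale.Law.clone _ _ *:%R _) (GRing.Scale.Law.clone _ _ *:%R _)
    (fun (a : R) (w : W) => a *: w).
Proof.
split=> [w|a] k x y /=.
- by rewrite scalerDl -scalerA.
- by rewrite scalerDr !scalerA mulrC.
Qed.

(** Scaling is a continuous bilinear map, so the product rule is the chain rule through the pair
    [(u, g)]. *)
Lemma is_diff_scale V W (u du : V -> R) (g dg : V -> W) x :
  is_diff x u du -> is_diff x g dg ->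
  is_diff x (fun y => u y *: g y) (fun v => u x *: dg v + du v *: g x).
Proof.
move=> du' dg'.
pose bM := bilinear_isBilinear.Build R R W W _ _ _ (@scaler_is_bilinear W).
pose b : {bilinear R -> W -> W} := HB.pack (fun (a : R) (w : W) => a *: w) bM.
have bc : continuous (fun p : R * W => b p.1 p.2).
  by move=> p; apply: (@cvgZ _ _ _ _ _ fst snd); [exact: cvg_fst|exact: cvg_snd].
have bd : is_diff (u x, g x) (fun p : R * W => b p.1 p.2)
                  (fun q => u x *: q.2 + q.1 *: g x).
  by apply: DiffDef; [exact: differentiable_bilin|rewrite diff_bilin].
exact: (is_diff_comp (is_diff_pair du' dg') bd).
Qed.

(** The first-order expansion with its little-o remainder depends only on the germ at [x];
    [diff_unique] then identifies its linear part with the differential of [g]. *)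
Lemma near_eq_differentiable V W (f g : V -> W) x :
  {near x, f =1 g} -> differentiable f x -> differentiable g x.
Proof.
move=> fg df; have := df => /diff_locallyP[dfc /eqaddoP fo].
have go : g \o shift x = cst (g x) + 'd f x +o_ 0 id.
  apply/eqaddoP => e e0; have := fo _ e0; rewrite /= => foe.
  have fgs : \forall h \near (0 : V), f (h + x) = g (h + x).
    by move: fg; rewrite (near_shift 0 x) subr0.
  apply: filterS2 fgs foe => h fgh.
  rewrite -[leLHS]/(`|f (h + x) - (f x + 'd f x h)|).
  by rewrite -[X in _ -> X <= _]/(`|g (h + x) - (g x + 'd f x h)|) fgh
    (nbhs_singleton fg).
by apply/diff_locallyP; rewrite (diff_unique dfc go).
Qed.

(** In finite dimension a linear map is a finite sum of coordinate functions times fixed vectors. *)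
Lemma linear_rV_continuous n W (f : {linear 'rV[R]_n -> W}) : continuous f.
Proof.
have -> : (f : _ -> _) =
    (fun v => \sum_i ((fun v : 'rV[R]_n => v 0 i : R) v) *: f (delta_mx 0 i)).
  apply/funext => v; rewrite [in LHS](row_sum_delta v) linear_sum/=.
  by apply: eq_bigr => i _; rewrite linearZ.
apply: continuous_big => [|i _]; first exact: add_continuous.
move=> x; apply: continuousZr_tmp; exact: (@coord_continuous _ 1 n 0 i x).
Qed.

End differentiability.

(** * Closure properties of the classes [Ck_on] *)

Section Ck.
Context {R : realType}.
Implicit Types V W : normedModType R.

(** Derivative formulas hold only on [U], while ['D_v f] is a total function. Since [U] is open,
    agreement on [U] is agreement near each of its points, so derivatives may be replaced by their
    formulas in the inductions below. *)
Lemma Ck_on_ext V W k (U : set V) (f g : V -> W) :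
  open U -> {in U, f =1 g} -> Ck_on k U f -> Ck_on k U g.
Proof.
move=> oU; elim: k f g => [|k IH] f g fg /=.
  move=> fc x Ux; have fgx : {near x, f =1 g}.
    by near=> y; apply: fg; rewrite inE; near: y; exact: open_nbhs_nbhs.
  rewrite /prop_for /continuous_at -(nbhs_singleton fgx).
  by apply: cvg_trans (fc _ Ux); exact: near_eq_cvg.
have fgU x : U x -> {near x, f =1 g}.
  move=> Ux; near=> y; apply: fg; rewrite inE; near: y.
  exact: open_nbhs_nbhs.
move=> [df Df]; split=> [x Ux|v].
  exact: near_eq_differentiable (fgU _ Ux) (df _ Ux).
apply: IH (Df v) => x; rewrite inE => Ux.
exact: near_eq_derive (fgU _ Ux).
Unshelve. all: by end_near. Qed.

Lemma Ck_onS V W k (U U' : set V) (f : V -> W) :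
  U' `<=` U -> Ck_on k U f -> Ck_on k U' f.
Proof.
move=> U'U; elim: k f => [|k IH] f /= => [fc x /U'U|[df Df]]; first exact: fc.
by split=> [x /U'U|v]; [exact: df|exact: (IH _ (Df v))].
Qed.

Lemma Ck_onD V W k (U : set V) (f g : V -> W) : open U ->
  Ck_on k U f -> Ck_on k U g -> Ck_on k U (fun x => f x + g x).
Proof.
move=> oU; elim: k f g => [|k IH] f g /=.
  by move=> fc gc x Ux; apply: continuousD; [exact: fc|exact: gc].
move=> [df Df] [dg Dg]; split=> [x Ux|v].
  by apply: differentiableD; [exact: df|exact: dg].
apply: Ck_on_ext (IH _ _ (Df v) (Dg v)) => // x; rewrite inE => Ux.
rewrite [RHS]deriveD//; apply: diff_derivable; first exact: df.
exact: dg.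
Qed.

Lemma Ck_onZ V W k (U : set V) (a : R) (f : V -> W) : open U ->
  Ck_on k U f -> Ck_on k U (fun x => a *: f x).
Proof.
move=> oU; elim: k f => [|k IH] f /=.
  by move=> fc x Ux; apply: continuousZl_tmp; exact: fc.
move=> [df Df]; split=> [x Ux|v].
  by apply: differentiableZ; exact: df.
apply: Ck_on_ext (IH _ (Df v)) => // x; rewrite inE => Ux.
by rewrite [RHS]deriveZ//; apply/diff_derivable/df.
Qed.

Lemma Ck_on_pred V W k (U : set V) (f : V -> W) : Ck_on k.+1 U f -> Ck_on k U f.
Proof.
elim: k f => [|k IH] f [df Df] /=; last by split => // v; exact: IH.
by move=> x Ux; exact/differentiable_continuous/df.
Qed.

(** The derivative of [f \o l] along [v] is the derivative of [f] along the fixed vector [l v],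
    composed with [l]. It has the same shape, so induction on [k] closes. *)
Lemma Ck_on_comp_linear V V' W k (U : set V) (f : V -> W)
    (l : {linear V' -> V}) : open U -> continuous l ->
  Ck_on k U f -> Ck_on k (l @^-1` U) (fun x => f (l x)).
Proof.
move=> oU lc; elim: k f => [|k IH] f /=.
  by move=> fc x Ux; apply: continuous_comp; [exact: lc|exact: fc].
move=> [df Df].
have dfl x : U (l x) -> differentiable (f \o l) x.
  by move=> Ux; apply: differentiable_comp; [exact: linear_differentiable|exact: df].
split=> [x Ux|v]; first exact: dfl.
apply: Ck_on_ext (IH _ (Df (l v))) => [|x].
  by apply: open_comp oU => x _; exact: lc.
rewrite inE => /= Ux; rewrite [RHS](deriveE _ (dfl _ Ux)) deriveE; last exact: df.
have dlx : differentiable l x by exact: linear_differentiable.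
have dflx : differentiable f (l x) by exact: df.
by rewrite (diff_comp dlx dflx)/= (diff_lin _ lc).
Qed.

(** For linear [u] the derivative along [v] is [u x *: 'D_v f x + u v *: f x], where [u v] is
    constant: the first term falls under the induction hypothesis, the second is a constant multiple
    of [f]. *)
Lemma Ck_onZ_linear V W k (U : set V) (u : {linear V -> R}) (f : V -> W) :
  open U -> continuous u -> Ck_on k U f -> Ck_on k U (fun x => u x *: f x).
Proof.
move=> oU uc; elim: k f => [|k IH] f /=.
  by move=> fc x Ux; apply: continuousZ; [exact: uc|exact: fc].
move=> [df Df].
have duf x : U x -> is_diff x (fun y => u y *: f y)
    (fun v => u x *: 'd f x v + u v *: f x).
  move=> Ux; apply: is_diff_scale; last exact/differentiableP/df.
  by apply: DiffDef; [exact: linear_differentiable|rewrite diff_lin].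
split=> [x Ux|v]; first by have [] := duf _ Ux.
have DU : Ck_on k U (fun x => u x *: 'D_v f x + u v *: f x).
  apply: Ck_onD => //; first exact: (IH _ (Df v)).
  by apply: Ck_onZ => //; apply: Ck_on_pred; split.
apply: Ck_on_ext DU => // x; rewrite inE => Ux.
have [duUx E] := duf _ Ux.
by rewrite [RHS]deriveE// E deriveE//; exact: df.
Qed.

End Ck.

(** * Estimates in the maximum norm *)

Section matrix_norm.
Context {R : realType}.

Lemma mx_entry_le m n (A : 'M[R]_(m, n)) i j : `|A i j| <= `|A|.
Proof.
rewrite [leRHS]/Num.Def.normr/= mx_normrE.
exact: (le_bigmax _ (fun ij : 'I_m * 'I_n => `|A ij.1 ij.2|) (i, j)).
Qed.

Lemma mx_norm_le m n (A : 'M[R]_(m, n)) (e : R) :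
  0 <= e -> (forall i j, `|A i j| <= e) -> `|A| <= e.
Proof.
move=> e0 Ae; rewrite [leLHS]/Num.Def.normr/= mx_normrE.
by apply: bigmax_le => // -[i j] _; exact: Ae.
Qed.

(** The norm is the largest absolute value of an entry, so the factor [m%:R] counts the terms in one
    entry of the product. *)
Lemma norm_mulmx_le k m n (A : 'M[R]_(k, m)) (B : 'M[R]_(m, n)) :
  `|A *m B| <= m%:R * `|A| * `|B|.
Proof.
apply: mx_norm_le => [|i j]; first by rewrite !mulr_ge0.
rewrite mxE (le_trans (ler_norm_sum _ _ _))//.
have -> : m%:R * `|A| * `|B| = \sum_(l < m) `|A| * `|B|.
  by rewrite sumr_const card_ord -mulrA mulr_natl.
by apply: ler_sum => l _; rewrite normrM ler_pM// mx_entry_le.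
Qed.

Lemma segment_in_ball (V : normedModType R) (p x y : V) (r s : R) :
  0 <= s <= 1 -> ball p r x -> ball p r y -> ball p r (y + s *: (x - y)).
Proof.
move=> /andP[s0 s1]; rewrite -!ball_normE /ball_/= => px py.
have -> : p - (y + s *: (x - y)) = (1 - s) *: (p - y) + s *: (p - x).
  by rewrite scalerBl scale1r -addrA -scalerN -scalerDr opprB subrKA opprD addrA
      -scalerN opprB.
rewrite (le_lt_trans (ler_normD _ _))// !normrZ !ger0_norm ?subr_ge0//.
(* Strictness will come from the term multiplied by [s], hence the separate case. *)
have [->|sn0] := eqVneq s 0; first by rewrite subr0 mul1r mul0r addr0.
have sp : 0 < s by rewrite lt_def sn0.
have -> : r = (1 - s) * r + s * r by ring.
by rewrite ler_ltD ?ltr_pM2l// ler_wpM2l ?subr_ge0// ltW.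
Qed.

End matrix_norm.

(** A named projection, to carry the linear structure declared below. *)
Definition row_coord (R : realType) n (i : 'I_n) (v : 'rV[R]_n) : R := v 0 i.

Lemma row_coord_is_linear (R : realType) n (i : 'I_n) : linear (@row_coord R n i).
Proof. by move=> a u v; rewrite /row_coord !mxE. Qed.

HB.instance Definition _ (R : realType) n (i : 'I_n) :=
  GRing.isLinear.Build R 'rV[R]_n R _ (@row_coord R n i)
    (@row_coord_is_linear R n i).

(** * Immersions are locally bi-Lipschitz from below and give charts *)

Section local_immersion.
Context {R : realType}.

Lemma mul_jacobian m n (F : 'rV[R]_m -> 'rV[R]_n) x v :
  v *m jacobian F x = 'd F x v.
Proof. by rewrite /jacobian mul_rV_lin1. Qed.

(** Row [i] of the Jacobian is the derivative along the [i]-th basis vector, which is continuous;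
    finitely many rows give a uniform bound. *)
Lemma cvg_jacobian m n (V : set 'rV[R]_m) (F : 'rV[R]_m -> 'rV[R]_n) p :
  open V -> Ck_on 1 V F -> V p ->
  forall e, 0 < e -> \forall x \near p, `|jacobian F x - jacobian F p| <= e.
Proof.
move=> oV [dF DF] Vp e e0; near=> x.
have Vx : V x by near: x; exact: open_nbhs_nbhs.
apply: mx_norm_le => [|i j]; first exact: ltW.
have : `|'D_(delta_mx 0 i) F p - 'D_(delta_mx 0 i) F x| <= e.
  move: i {j}; near: x; apply: filter_forall => i.
  by apply: cvgr_dist_le e0; exact: (DF (delta_mx 0 i) p Vp).
rewrite distrC !deriveE; [|exact: dF..].
have <- : row i (jacobian F x - jacobian F p) =
    'd F x (delta_mx 0 i) - 'd F p (delta_mx 0 i).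
  by rewrite rowE mulmxBr; congr (_ - _); exact: mul_jacobian.
move=> /(le_trans _); apply.
have -> : (jacobian F x - jacobian F p) i j =
    row i (jacobian F x - jacobian F p) 0 j by rewrite [RHS]mxE.
exact: mx_entry_le.
Unshelve. all: by end_near. Qed.

(* Composing F with a left inverse B of its differential at p makes the
   differential of F *m B close to the identity near p; the mean value theorem,
   applied to the coordinate in which x - y is largest, then gives the
   estimate. *)
Lemma immersion_lower_bound m n (V : set 'rV[R]_m) (F : 'rV[R]_m -> 'rV[R]_n) p :
  open V -> Ck_on 1 V F -> V p -> injective ('d F p) ->
  exists r c : R, [/\ 0 < r, 0 < c, ball p r `<=` V,
    forall x, ball p r x -> injective ('d F x) &
    forall x y, ball p r x -> ball p r y -> `|x - y| <= c * `|F x - F y|].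
Proof.
move=> oV CF Vp dFp; have [dF DF] := CF.
(* Vectors are rows, so the left inverse of the differential is a right inverse [B] of the Jacobian
   matrix. *)
have /row_freeP[B JB] : row_free (jacobian F p).
  apply: inj_row_free => v; rewrite mul_jacobian => dv0.
  by apply: dFp; rewrite dv0 linear0.
(* Multiplication by [B] on the right has norm at most [b], and [e] is chosen so that
   [m%:R * b * e <= 1/2]; the added 1 keeps the denominator positive. *)
pose b : R := n%:R * `|B|; pose e : R := (2 * (m%:R * b + 1))^-1.
have b0 : 0 <= b by rewrite mulr_ge0.
have mb0 : 0 <= m%:R * b by rewrite mulr_ge0.
have e0 : 0 < e by rewrite invr_gt0; lra.
have : \forall x \near p, `|jacobian F x - jacobian F p| <= e /\ V x.
  by near=> x; split; near: x; [exact: (cvg_jacobian oV)|exact: open_nbhs_nbhs].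
move=> /nbhs_ballP[r /= r0 rP].
have close x (v : 'rV_m) : ball p r x -> `|v *m jacobian F x *m B - v| <= `|v| / 2.
  move=> /rP[xe _].
  (* As [v] equals [v *m jacobian F p *m B], the difference is
     [v *m (jacobian F x - jacobian F p) *m B]. *)
  rewrite -[X in _ - X](mulmx1 v) -JB [X in _ - X]mulmxA -mulmxBl -mulmxBr.
  rewrite (le_trans (norm_mulmx_le _ _))// mulrAC -/b.
  rewrite (le_trans (ler_wpM2l b0 (norm_mulmx_le _ _)))//.
  rewrite (@le_trans _ _ (b * (m%:R * `|v| * e)))//.
    by rewrite !ler_wpM2l// mulr_ge0.
  have -> : b * (m%:R * `|v| * e) = `|v| * (m%:R * b * e) by ring.
  rewrite ler_wpM2l// /e invfM mulrCA ler_piMr// ler_pdivrMr; lra.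
(* The final estimate is [|x - y| <= b * |F x - F y| + |x - y| / 2]; replacing [b] by [b + 1] makes
   the constant positive. *)
exists r, (2 * (b + 1)); split; first exact: r0.
- by lra.
- by move=> x /rP[].
- move=> x px v w vw; apply/eqP; rewrite -subr_eq0 -normr_le0.
  have := close x (v - w) px.
  by rewrite mul_jacobian linearB/= vw subrr mul0mx sub0r normrN; lra.
move=> x y px py.
have [->|xy] := eqVneq x y; first by rewrite !subrr !normr0 mulr0.
have /mx_norm_neq0[[i j] /= ijE] : mx_norm (x - y) != 0.
  by rewrite -[mx_norm _]/(`|x - y|) normr_eq0 subr_eq0.
rewrite -[mx_norm _]/(`|x - y|) ord1 in ijE.
pose g (s : R) : R := (F (y + s *: (x - y)) *m B) 0 j.
pose dg (s : R) : R := ((x - y) *m jacobian F (y + s *: (x - y)) *m B) 0 j.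
have seg (s : R) : s \in `[(0 : R), 1] -> ball p r (y + s *: (x - y)).
  by rewrite in_itv/= => s01; exact: segment_in_ball.
have gd (s : R) : s \in `[(0 : R), 1] -> is_derive s 1 g (dg s).
  move=> /seg/rP[_ Vs].
  pose h (t : R) : 'rV[R]_m := y + t *: (x - y).
  have dh : is_diff s h ( *:%R^~ (x - y)).
    apply: is_diff_eq (is_diffD (is_diff_cst y s) (is_diff_scalel s (x - y))) _.
    by apply/funext => t; rewrite fctE add0r.
  pose l : {linear 'rV[R]_n -> R} := row_coord j \o mulmxr B.
  have dl : is_diff (F (h s)) l l.
    apply: DiffDef; first exact/linear_differentiable/linear_rV_continuous.
    exact/diff_lin/linear_rV_continuous.
  have dFh : is_diff (h s) F ('d F (h s)) by exact/differentiableP/dF.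
  have [dg_ex dgE] := is_diff_comp dh (is_diff_comp dFh dl).
  apply: DeriveDef; first exact: diff_derivable.
  rewrite (deriveE _ dg_ex) dgE /= scale1r /dg /row_coord.
  by congr ((_ *m B) 0 j); rewrite /= mul_jacobian.
have gd' (s : R) : s \in `](0 : R), 1[ -> is_derive s 1 g (dg s).
  by move=> s01; apply: gd; exact: subset_itv_oo_cc.
have gc : {within `[(0 : R), 1], continuous g}.
  by apply: derivable_within_continuous => s /gd[].
have [c c01 gE] := MVT ltr01 gd' gc.
rewrite subr0 mulr1 in gE.
have {}c01 : c \in `[(0 : R), 1] by exact: subset_itv_oo_cc.
have := close _ (x - y) (seg _ c01).
move=> /(le_trans (mx_entry_le _ 0 j)).
rewrite mxE [X in _ + X]mxE -/(dg c) -gE => dgc.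
have : `|g 1 - g 0| <= b * `|F x - F y|.
  have -> : g 1 - g 0 = ((F x - F y) *m B) 0 j.
    by rewrite /g scale1r scale0r addr0 subrKC mulmxBl !mxE.
  by rewrite (le_trans (mx_entry_le _ _ _))// (le_trans (norm_mulmx_le _ _))// mulrAC.
have : `|x - y| <= `|g 1 - g 0| + `|g 1 - g 0 - (x - y) 0 j|.
  rewrite [X in X <= _]ijE -[X in `|X| <= _](subKr (g 1 - g 0)).
  exact: ler_normB.
have : 0 <= `|F x - F y| by [].
have -> : 2 * (b + 1) * `|F x - F y| = 2 * (b * `|F x - F y|) + 2 * `|F x - F y|.
  by ring.
by lra.
Unshelve. all: by end_near. Qed.

End local_immersion.

(** The lower bound gives injectivity and a Lipschitz inverse on the image, which makes [F] open
    onto its image. *)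
Lemma open_immersion_parameterization (R : realType) k m (V : set 'rV[R]_k)
    (F : 'rV[R]_k -> 'rV[R]_m) (c : R) :
  open V -> immersion_on V F -> 0 < c ->
  (forall x y, V x -> V y -> `|x - y| <= c * `|F x - F y|) ->
  local_parameterization (F @` V) V F.
Proof.
move=> oV iF c0 cF; split => //.
  move=> x y; rewrite !inE => Vx Vy Fxy; apply/eqP.
  rewrite -subr_eq0 -normr_le0; have := cF _ _ Vx Vy.
  by rewrite Fxy subrr normr0 mulr0.
move=> V' oV' V'V.
(* If the ball of radius [r] about [x] lies in [V'], any [F y] at distance less than [r / c] from
   [F x] has [y] in that ball. The union of these image balls is the required open set. *)
pose D := [set z : 'rV[R]_k * R | V' z.1 /\ ball z.1 z.2 `<=` V'].
exists (\bigcup_(z in D) ball (F z.1) (z.2 / c)).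
  by apply: bigcup_open => z _; exact: ball_open.
apply/seteqP; split => [_ [x V'x <-]|_ [[y Vy <-]] [[x r] [/= V'x xV']]].
  split; first by exists x => //; exact: V'V.
  have /nbhs_ballP[r /= r0 rV'] : nbhs x V' by exact: open_nbhs_nbhs.
  by exists (x, r) => //=; apply: ballxx; rewrite divr_gt0.
rewrite -ball_normE /ball_/= ltr_pdivlMr// => xy.
exists y => //; apply: xV'; rewrite -ball_normE /ball_/=.
by apply: le_lt_trans xy; rewrite mulrC; apply: cF => //; exact: V'V.
Qed.

(** * The envelope as a map on row vectors *)

Section envelope.
Context {R : realType} (n m : nat).
Variables (phi xi : 'rV[R]_n -> 'rV[R]_m).

(** Charts are defined on row vectors, so [(t, u)] is encoded as one row. The parameter [u] comes
    first because [1 + n] computes to [n.+1]. *)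
Definition row_pair (s : 'rV[R]_(1 + n)) : 'rV[R]_n * R :=
  (rsubmx s, row_coord (lshift n 0) s).

Definition pair_row (p : 'rV[R]_n * R) : 'rV[R]_(1 + n) :=
  row_mx p.2%:M p.1.

Lemma row_pairK : cancel row_pair pair_row.
Proof.
move=> s; rewrite /pair_row /row_pair /= -[RHS](hsubmxK s); congr (row_mx _ _).
by apply/rowP => i; rewrite !ord1 !mxE eqxx mulr1n.
Qed.

Lemma pair_rowK : cancel pair_row row_pair.
Proof.
move=> [t u]; rewrite /pair_row /row_pair /= row_mxKr; congr pair.
by rewrite /row_coord row_mxEl mxE eqxx.
Qed.

(** Product and row space both carry the maximum norm, so a radius found for rows also serves for
    pairs. *)
Lemma ball_pair_row p q r : ball p r q -> ball (pair_row p) r (pair_row q).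
Proof.
move=> [[r0 pq1] pq2]; split => // i j; rewrite /pair_row ord1.
case: (split_ordP j) => {}j ->; last by rewrite !row_mxEr; exact: pq1.
by rewrite !row_mxEl ord1 !mxE eqxx !mulr1n.
Qed.

Lemma row_pair_continuous : continuous row_pair.
Proof.
move=> s; apply/differentiable_continuous/differentiable_pair.
  exact: differentiable_rsubmx.
exact/linear_differentiable/linear_rV_continuous.
Qed.

Definition row_envelope (s : 'rV[R]_(1 + n)) : 'rV[R]_m :=
  envelope phi xi (row_pair s).

Lemma smooth_row_envelope U : open U -> smooth_on U phi -> smooth_on U xi ->
  smooth_on (rsubmx @^-1` U) row_envelope.
Proof.
move=> oU sphi sxi k.
have oU' : open ((rsubmx : 'rV[R]_(1 + n) -> 'rV[R]_n) @^-1` U).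
  by apply: open_comp oU => s _; exact: continuous_rsubmx.
apply: Ck_onD => //.
  by apply: Ck_on_comp_linear (sphi k) => //; exact: continuous_rsubmx.
apply: Ck_onZ_linear => //; first exact: linear_rV_continuous.
by apply: Ck_on_comp_linear (sxi k) => //; exact: continuous_rsubmx.
Qed.

Lemma diff_row_envelope s t u v : row_pair s = (t, u) ->
  differentiable phi t -> differentiable xi t ->
  'd row_envelope s v = 'd phi t (rsubmx v) +
    (u *: 'd xi t (rsubmx v) + row_coord (lshift n 0) v *: xi t).
Proof.
move=> [<- <-] /differentiableP dphi /differentiableP dxi.
have dr : is_diff s (rsubmx : 'rV[R]_(1 + n) -> _) rsubmx.
  apply: DiffDef; first exact: differentiable_rsubmx.
  exact/diff_lin/continuous_rsubmx.
have du : is_diff s (row_coord (lshift n 0)) (row_coord (lshift n 0)).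
  apply: DiffDef; first exact/linear_differentiable/linear_rV_continuous.
  exact/diff_lin/linear_rV_continuous.
have [_ ->//] := is_diffD (is_diff_comp dr dphi)
  (is_diff_scale du (is_diff_comp dr dxi)).
Qed.

End envelope.

(** * Smoothness of the envelope *)

Theorem corollary2p9 (R : realType) (n : nat)
    (M : set 'rV[R]_n.+2) (N : topologicalType) (iota : N -> 'rV[R]_n.+2)
    (U : set 'rV[R]_n) (psi : 'rV[R]_n -> N) (phi : 'rV[R]_n -> 'rV[R]_n.+2)
    (L : 'rV[R]_n -> set 'rV[R]_n.+2) (xi : 'rV[R]_n -> 'rV[R]_n.+2)
    (S1 : 'rV[R]_n -> 'M[R]_n) (tau : 'rV[R]_n -> 'rV[R]_n -> R)
    (t0 : 'rV[R]_n) (u0 : R) :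
  smooth_hypersurface M ->
  immersed_hypersurface_of M iota ->
  nondegenerate_immersion M iota ->
  parameterization_of iota U psi phi ->
  osculating_darboux_direction M U phi L ->
  smooth_on U xi ->
  (forall t, U t -> L t (xi t) /\ xi t != 0) ->
  shape_operator U phi xi S1 tau ->
  U t0 ->
  (forall lambda : R, lambda != 0 -> eigenvalue (S1 t0) lambda ->
     u0 != lambda^-1) ->
  smooth_hypersurface_at (U `*` [set: R]) (envelope phi xi) (t0, u0).
Proof.
move=> _ _ _ [oU _ _ _ [[sphi iphi] _]] odd sxi Lxi shp Ut0 noeig.
(* Both [xi t0] and [zeta t0] span the line [L t0], so [xi t0] inherits transversality to [N] from
   [zeta t0]. *)
have xiN : ~ tangent_image phi t0 (xi t0).
  have [V [zeta [_ Vt0 _ _ /(_ _ Vt0)[_ zN _ LE]]]] := odd _ Ut0.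
  have [] := Lxi _ Ut0; rewrite LE => -[c _ <-] cz0 [X _ XE].
  have c0 : c != 0 by apply: contra_neq cz0 => ->; rewrite scale0r.
  by apply: zN; exists (c^-1 *: X) => //; rewrite linearZ/= XE scalerK.
have dphi : differentiable phi t0 by have [+ _] := sphi 1%N; exact.
have dxi : differentiable xi t0 by have [+ _] := sxi 1%N; exact.
pose s0 : 'rV[R]_(1 + n) := pair_row (t0, u0).
have s0E : row_pair s0 = (t0, u0) by exact: pair_rowK.
have t0E : rsubmx s0 = t0 by exact: row_mxKr.
pose F : 'rV[R]_(1 + n) -> 'rV[R]_n.+2 := row_envelope phi xi.
have dF : injective ('d F s0).
  suff ker v : 'd F s0 v = 0 -> v = 0.
    move=> v w vw; apply/eqP; rewrite -subr_eq0; apply/eqP/ker.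
    by rewrite linearB/= vw subrr.
  pose X := rsubmx v; pose a := row_coord (lshift n 0) v.
  have dxiE : 'd xi t0 X = - 'd phi t0 (X *m S1 t0) + tau t0 X *: xi t0.
    by rewrite -shp// deriveE.
  have dFE := diff_row_envelope v s0E dphi dxi.
  move=> dv0; have {dFE}dv0 := etrans (esym dFE) dv0.
  rewrite -/X -/a [X in _ + (_ *: X + _)]dxiE in dv0.
  pose Y := X - u0 *: (X *m S1 t0); pose b := u0 * tau t0 X + a.
  have {}dv0 : 'd phi t0 Y + b *: xi t0 = 0.
    rewrite -[RHS]dv0 linearB linearZ/= scalerDr scalerN scalerDl scalerA.
    by rewrite !addrA.
  have b0 : b = 0.
    (* Otherwise [xi t0] would be the image of [- b^-1 *: Y], hence tangent to [N]. *)
    apply: contra_notP xiN => /eqP b0; exists (- b^-1 *: Y) => //.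
    rewrite linearZ/= -[LHS]subr0 -[X in _ - X](scaler0 _ (- b^-1)) -dv0.
    by rewrite scalerDr opprD addrA subrr sub0r scaleNr opprK scalerK.
  have Y0 : Y = 0.
    apply: (iphi _ Ut0); rewrite linear0.
    by move: dv0; rewrite b0 scale0r addr0.
  have X0 : X = 0.
    apply/eqP/negP => /negP Xn0; move/eqP : Y0; rewrite subr_eq0 => /eqP XE.
    (* The relation [X = u0 *: (X *m S1 t0)] excludes [u0 = 0] when [X] is non-zero, so [u0^-1] is a
       non-zero eigenvalue with inverse [u0]. *)
    have u0n0 : u0 != 0 by apply: contra_neq Xn0 => u00; rewrite XE u00 scale0r.
    have : eigenvalue (S1 t0) u0^-1.
      by apply/eigenvalueP; exists X => //; rewrite [in RHS]XE scalerK.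
    by move=> /(noeig _ (invr_neq0 u0n0)); rewrite invrK eqxx.
  have a0 : a = 0.
    (* Linearity of [tau t0] is not a hypothesis; its value at 0 follows from the shape equation at
       [X = 0], since [xi t0] is non-zero. *)
    have tau0 : tau t0 0 = 0.
      have := shp _ Ut0 0; rewrite derive0 mul0mx linear0 oppr0 add0r => /esym/eqP.
      by rewrite scaler_eq0 (negbTE (Lxi _ Ut0).2) orbF => /eqP.
    by move: b0; rewrite /b X0 tau0 mulr0 add0r.
  rewrite -(row_pairK v) /row_pair -/X -/a X0 a0 /pair_row /=.
  by rewrite raddf0 row_mx0.
pose W : set 'rV[R]_(1 + n) := rsubmx @^-1` U.
have oW : open W by apply: open_comp oU => s _; exact: continuous_rsubmx.
have sF : smooth_on W F by exact: smooth_row_envelope.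
have Ws0 : W s0 by rewrite /W /= t0E.
have [r [c [r0 c0 rW dFr cF]]] := immersion_lower_bound oW (sF 1%N) Ws0 dF.
have Or q : ball (t0, u0) r q -> ball s0 r (pair_row q) by exact: ball_pair_row.
exists (ball (t0, u0) r); split.
- exact: ball_open.
- exact: ballxx.
- by move=> q /Or/rW; rewrite /W /= /pair_row row_mxKr.
move=> O' oO' _ O'O p [q O'q <-].
pose V := row_pair (n := n) (R := R) @^-1` O'.
have oV : open V by apply: open_comp oO' => s _; exact: row_pair_continuous.
have Vr : V `<=` ball s0 r by move=> s /O'O/Or; rewrite row_pairK.
have -> : envelope phi xi @` O' = F @` V.
  apply/seteqP; split => [_ [x O'x <-]|_ [s Vs <-]]; last by exists (row_pair s).
  by exists (pair_row x); rewrite /V /F /row_envelope /= ?pair_rowK.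
(* The single chart [F] on [V] covers the whole image of [O']. *)
exists V, F; split; last first.
  by exists (pair_row q); rewrite /V /F /row_envelope /= ?pair_rowK.
apply: (open_immersion_parameterization oV _ c0).
  split=> [k|s /Vr]; last exact: dFr.
  by apply: Ck_onS (sF k); exact: subset_trans rW.
by move=> x y /Vr + /Vr; exact: cF.
Qed.
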